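(* For $n\ge2$, $$\sum_{\sigma\in\mathcal D^D_n}q^{\mathrm{Dmaj}(\sigma)}=[2]_q[4]_q\cdots[2n-2]_q\sum_{k=0}^{n-2}\frac{(-1)^kq^{2\binom k2}}{[2]_q[4]_q\cdots[2k]_q}\left(q^{2k+1}[n-1-k]_q+\frac12\left(1-\left(\frac{1-q}{1+q}\right)^{n-k-1}\right)\right).$$
   Context: $B_n$ is the set of words $\sigma=\sigma_1\cdots\sigma_n$ with $\sigma_i\in\{\pm1,\dots,\pm n\}$ and $|\sigma_1|\cdots|\sigma_n|$ a permutation of $[n]$; $\mathrm{neg}(\sigma)$ is the number of negative letters; $D_n=\{\sigma\in B_n:\mathrm{neg}(\sigma)\text{ even}\}$; $\mathcal D^D_n$ is the set of $\sigma\in D_n$ with $\sigma_i\ne i$ for all $i$. Order $\prec$ on nonzero integers: $-1\prec-2\prec\cdots\prec-N\prec1\prec\cdots\prec N$. For a word $w$ of distinct nonzero integers, $\mathrm{maj}_\prec(w)=\sum_{i:w_i\succ w_{i+1}}i$ and $\mathrm{fmaj}(w)=2\mathrm{maj}_\prec(w)+\mathrm{neg}(w)$. For $\sigma\in D_n$, $\mathrm{Dmaj}(\sigma)=\mathrm{fmaj}(\sigma_1\cdots\sigma_{n-1}|\sigma_n|)$. $[m]_q=1+q+\dots+q^{m-1}$; empty products equal $1$. *)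

(* Defs.v *)
From mathcomp Require Import all_boot all_order all_algebra all_fingroup.
Set Implicit Arguments. Unset Strict Implicit. Unset Printing Implicit Defensive.
Import Order.TTheory GRing.Theory Num.Theory.

(* A signed permutation sigma in B_n is encoded as a pair (p, s) with
   p : {perm 'I_n} (giving |sigma_i| = p(i-1) + 1) and s : {ffun 'I_n -> bool}
   (s i = true iff sigma_{i+1} is negative).  This is a bijection with B_n. *)
Definition signed_perm (n : nat) : finType := ({perm 'I_n} * {ffun 'I_n -> bool})%type.

Definition sp_word n (sg : signed_perm n) : seq int :=
  [seq (if sg.2 i then - (Posz (sg.1 i).+1) else Posz (sg.1 i).+1)%R | i <- enum 'I_n].

Definition negw (w : seq int) : nat := count (fun x : int => (x < 0)%R) w.

(* the order -1 < -2 < ... < -N < 1 < ... < N on nonzero integers (strict) *)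
Definition prec (x y : int) : bool :=
  if (x < 0)%R then (if (y < 0)%R then (y < x)%R else true)
  else (if (y < 0)%R then false else (x < y)%R).

Definition majp (w : seq int) : nat :=
  \sum_(j < (size w).-1 | prec (nth 0%R w j.+1) (nth 0%R w j)) j.+1.

Definition fmaj (w : seq int) : nat := 2 * majp w + negw w.

Definition inD n (sg : signed_perm n) : bool := ~~ odd (negw (sp_word sg)).

Definition inDD n (sg : signed_perm n) : bool :=
  inD sg && [forall i : 'I_n, nth 0%R (sp_word sg) i != Posz i.+1].

Definition Dmaj n (sg : signed_perm n) : nat :=
  let w := sp_word sg in
  fmaj (rcons (take n.-1 w) (Posz `|last 0%R w|%N)).

Definition qint (R : nzRingType) (m : nat) (q : R) : R := (\sum_(i < m) q ^+ i)%R.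

(* Main.v *)
Require Import Defs.
From mathcomp Require Import all_boot all_order all_algebra all_fingroup.
From mathcomp Require Import ring zify.
Import Order.TTheory GRing.Theory Num.Theory.
Local Open Scope ring_scope.

(** Let [p = q ^ 2].  Flipping the sign of the last letter reduces the sum to
    [X_n + Y_(n-1)], where [X_n] runs over the type B derangements of [n] with
    positive last letter, and [Y_m] over those of [m] with an odd number of
    negative letters, both weighted by [q ^ fmaj].

    Fix a derangement of [k] letters and insert [n - k] fixed points in all
    possible ways.  As observed by Wachs, a fixed point behaves for descents like
    a letter lying between the excedances and all other letters, so that
    [p ^ maj] sums to [p ^ maj] of the derangement times the [p]-binomial
    [n, k]; if the last letter is not to be fixed, the factor is
    [p ^ (n - k) [n - 1, k - 1]].  Hence the known sums over all signed
    permutations, and over those whose last letter is positive and different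
    from [n], are [p]-binomial transforms of the derangement sums (with
    [(1 + t) ^ n [n]_p!] at [t = q] and [t = - q] isolating the parity of the
    number of negative letters).  Inverting these transforms gives the formula. *)

Set Implicit Arguments.
Unset Strict Implicit.
Unset Printing Implicit Defensive.

(** * Gaussian binomials *)

Section QBinomial.
Variables (R : comNzRingType) (p : R).

Fixpoint qbin (n k : nat) : R :=
  match n, k with
  | _, 0 => 1
  | 0, _.+1 => 0
  | n'.+1, k'.+1 => qbin n' k' + p ^+ k * qbin n' k
  end.

Definition qfact (n : nat) : R := \prod_(1 <= i < n.+1) qint i p.

Lemma qint0 : qint 0 p = 0. Proof. exact: big_ord0. Qed.

Lemma qintSl n : qint n.+1 p = 1 + p * qint n p.
Proof.
rewrite /qint big_ord_recl expr0 mulr_sumr; congr (_ + _).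
by apply: eq_bigr => i _; rewrite exprS.
Qed.

Lemma qintSr n : qint n.+1 p = qint n p + p ^+ n.
Proof. exact: big_ord_recr. Qed.

Lemma qintD m n : qint (m + n) p = qint m p + p ^+ m * qint n p.
Proof.
elim: n => [|n IH]; first by rewrite addn0 qint0 mulr0 addr0.
by rewrite addnS !qintSr IH mulrDr exprD addrA.
Qed.

Lemma qfact0 : qfact 0 = 1. Proof. by rewrite /qfact big_nil. Qed.

Lemma qfactS n : qfact n.+1 = qfact n * qint n.+1 p.
Proof. by rewrite /qfact big_nat_recr. Qed.

Lemma qbin0 n : qbin n 0 = 1. Proof. by case: n. Qed.

Lemma qbinS n k : qbin n.+1 k.+1 = qbin n k + p ^+ k.+1 * qbin n k.+1.
Proof. by []. Qed.

Lemma qbin_small n k : (n < k)%N -> qbin n k = 0.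
Proof.
by elim: n k => [|n IH] [|k] //= h; rewrite !IH ?mulr0 ?addr0 //; lia.
Qed.

Lemma qbinn n : qbin n n = 1.
Proof. by elim: n => //= n ->; rewrite qbin_small // mulr0 addr0. Qed.

Lemma qbinS' n k : (k <= n)%N ->
  qbin n.+1 k.+1 = p ^+ (n - k) * qbin n k + qbin n k.+1.
Proof.
elim: n k => [|n IH] [|k] // h.
- by rewrite /= mulr0 !addr0 mulr1.
- by rewrite [LHS]qbinS [in LHS]IH // [in RHS]qbinS !qbin0 !subn0 !exprS; ring.
rewrite [LHS]qbinS [in LHS]IH // [in RHS](qbinS n k.+1) [in RHS](qbinS n k) subSS.
have [hk|hk] := ltnP k n; last first.
  have -> : k = n by lia.
  by rewrite (@qbin_small n n.+1) // (@qbin_small n n.+2) // (@qbin_small n.+1 n.+2) //; ring.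
rewrite (IH k.+1) // -[(n - k)%N]prednK ?subn_gt0 // -subnS !exprS; ring.
Qed.

Lemma qbin_fact n k : (k <= n)%N -> qbin n k * qfact k * qfact (n - k) = qfact n.
Proof.
elim: n k => [|n IH] [|k] // h; first by rewrite !qfact0 !mulr1.
  by rewrite qbin0 qfact0 subn0 !mul1r.
have e1 := IH k h; rewrite subSS qbinS qfactS.
have [hk|hk] := ltnP k n; last first.
  have -> : k = n by lia.
  by rewrite (@qbin_small n n.+1) // subnn qfact0 qbinn qfactS; ring.
have e2 := IH k.+1 hk.
have en : (n - k)%N = (n - k.+1).+1 by lia.
(* From [[n + 1] = [k + 1] + p ^ (k + 1) [n - k]]: the subtracted part of the first summand cancels
   the second summand. *)
have -> : qint k.+1 p = qint n.+1 p - p ^+ k.+1 * qint (n - k) p.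
  have -> : n.+1 = (k.+1 + (n - k))%N by lia.
  by rewrite qintD addrK.
rewrite mulrDl mulrDl.
have -> : qbin n k * (qfact k * (qint n.+1 p - p ^+ k.+1 * qint (n - k) p)) *
   qfact (n - k) = qfact n * (qint n.+1 p - p ^+ k.+1 * qint (n - k) p).
  by rewrite -e1; ring.
have -> : p ^+ k.+1 * qbin n k.+1 *
  (qfact k * (qint n.+1 p - p ^+ k.+1 * qint (n - k) p)) * qfact (n - k) =
  p ^+ k.+1 * qint (n - k) p * qfact n.
  have -> : qint n.+1 p - p ^+ k.+1 * qint (n - k) p = qint k.+1 p.
    have -> : n.+1 = (k.+1 + (n - k))%N by lia.
    by rewrite qintD addrK.
  by rewrite -e2 {1}en qfactS -en qfactS; ring.
by rewrite qfactS; ring.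
Qed.

(* [x ^ n] and the products [(x - a)(x - a p)...(x - a p^(n-1))] are two bases
   of the polynomials; the linear functional sending [x ^ n] to [f n] sends the
   second basis to [d]. *)
Lemma qbin_inversion (a : R) (f d : nat -> R) :
  (forall n, f n = \sum_(k < n.+1) a ^+ (n - k) * qbin n k * d k) ->
  forall n, d n = \sum_(k < n.+1)
    (-1) ^+ k * a ^+ k * p ^+ 'C(k, 2) * qbin n k * f (n - k)%N.
Proof.
move=> fE n.
pose P k : {poly R} := \prod_(i < k) ('X - (a * p ^+ i)%:P).
have PS k : P k.+1 = P k * ('X - (a * p ^+ k)%:P) by rewrite /P big_ord_recr.
(* Multiplying by ['X = ('X - a p ^ k) + a p ^ k] makes the coefficients obey the recursion
   [qbinS]. *)
have XE m : 'X^m = \sum_(k < m.+1) (a ^+ (m - k) * qbin m k) *: P k.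
  elim: m => [|m IH].
    by rewrite big_ord1 /P big_ord0 qbin0 mulr1 scale1r.
  rewrite exprSr IH mulr_suml.
  under eq_bigr => k _ do
    (have -> : (a ^+ (m - k) * qbin m k) *: P k * 'X =
       (a ^+ (m - k) * qbin m k) *: P k.+1 +
       (a ^+ (m - k).+1 * p ^+ k * qbin m k) *: P k
     by rewrite PS -!mul_polyC exprS !polyCM; ring).
  rewrite big_split /= big_ord_recr /= [X in _ + X]big_ord_recl /=.
  rewrite [RHS]big_ord_recl [X in _ = _ + X]big_ord_recr /= addrCA; congr (_ + _).
    by rewrite !subn0 !qbin0 expr0 !mulr1.
  rewrite /bump /= add1n subnn -[_ + _ * _]/(qbin m.+1 m.+1) !qbinn addrAC.
  rewrite -big_split /=; congr (_ + _); last by rewrite subnn.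
  apply: eq_bigr => -[k hk] _ /=; rewrite add1n -scalerDl; congr (_ *: _).
  have -> : (m - k.+1).+1 = (m - k)%N by lia.
  by rewrite subSS; ring.
(* Here the new factor ['X - a p ^ m] is expanded, which calls for the other recursion [qbinS']. *)
have PE m : P m = \sum_(k < m.+1)
   ((-1) ^+ k * a ^+ k * p ^+ 'C(k, 2) * qbin m k) *: 'X^(m - k).
  elim: m => [|m IH].
    by rewrite big_ord1 /P big_ord0 qbin0 !mulr1 scale1r.
  rewrite PS IH mulr_suml.
  under eq_bigr => k _ do
    (have -> : ((-1) ^+ k * a ^+ k * p ^+ 'C(k, 2) * qbin m k) *: 'X^(m - k) *
        ('X - (a * p ^+ m)%:P) =
       ((-1) ^+ k * a ^+ k * p ^+ 'C(k, 2) * qbin m k) *: 'X^((m - k).+1) +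
       ((-1) ^+ k.+1 * a ^+ k.+1 * p ^+ ('C(k, 2) + m) * qbin m k) *: 'X^(m - k)
     by rewrite -!mul_polyC !exprS exprD !polyCM; ring).
  rewrite big_split /= big_ord_recl [X in _ + X]big_ord_recr /=.
  rewrite [RHS]big_ord_recl [X in _ = _ + X]big_ord_recr /= -!addrA.
  congr (_ + _); first by rewrite !subn0 !qbin0.
  rewrite /bump /= add1n addrA -big_split /=; congr (_ + _).
    apply: eq_bigr => -[k hk] _ /=; rewrite add1n subSS.
    have -> : (m - k.+1).+1 = (m - k)%N by lia.
    rewrite -scalerDl; congr (_ *: _); rewrite -[qbin m k + _]/(qbin m.+1 k.+1) qbinS'; last exact: ltnW.
    have -> : 'C(k.+1, 2) = ('C(k, 2) + k)%N by rewrite binS bin1 addnC.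
    have -> : ('C(k, 2) + m = 'C(k, 2) + k + (m - k))%N by lia.
    by rewrite !exprD; ring.
  rewrite subSS !subnn -[qbin m m + _]/(qbin m.+1 m.+1) !qbinn; congr (_ *: _).
  by rewrite binS bin1 [(_ + m)%N]addnC; ring.
(* The functional is cut off at degree [n], which is enough for [P 0], ..., [P n]. *)
pose L (Q : {poly R}) := \sum_(i < n.+1) Q`_i * f i.
have LZ c Q : L (c *: Q) = c * L Q.
  by rewrite /L mulr_sumr; apply: eq_bigr => i _; rewrite coefZ mulrA.
have LS m (Q : 'I_m -> {poly R}) : L (\sum_(k < m) Q k) = \sum_(k < m) L (Q k).
  rewrite /L exchange_big; apply: eq_bigr => i _.
  by rewrite coef_sum mulr_suml.
have LX m : (m <= n)%N -> L 'X^m = f m.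
  move=> hm; have hm' : (m < n.+1)%N by [].
  rewrite /L (bigD1 (Ordinal hm')) //= coefXn eqxx mul1r big1 ?addr0 // => i hi.
  by rewrite coefXn; case: eqVneq => [e|_]; rewrite ?mul0r //;
     case/eqP: hi; apply/val_inj.
(* The change of basis is unitriangular: the terms of [XE] below the top one agree by induction,
   hence so do the top ones. *)
have LP m : (m <= n)%N -> L (P m) = d m.
  elim/ltn_ind: m => m IH hm.
  have : L 'X^m = f m by exact: LX.
  rewrite XE LS fE !big_ord_recr /= !LZ subnn qbinn !mul1r.
  rewrite (eq_bigr (fun k : 'I_m => a ^+ (m - k) * qbin m k * d k)).
    by move/addrI.
  by move=> k _; rewrite LZ IH //; case: k => k /=; lia.
rewrite -LP // PE LS; apply: eq_bigr => k _.
by rewrite LZ LX // leq_subr.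
Qed.

End QBinomial.
Arguments qbin : simpl never.

(** * Inserting fixed points *)

Definition head_desc (y : int) (u : seq int) : bool :=
  if u is x :: _ then prec y x else false.

(* Words are stored in reverse: the head of [u] is the last letter of the word
   and stands at position [size u]. *)
Fixpoint rmaj (u : seq int) : nat :=
  if u is y :: u' then (rmaj u' + head_desc y u' * size u')%N else 0%N.

Fixpoint der_word (u : seq int) : bool :=
  if u is y :: u' then (y != Posz (size u').+1) && der_word u' else true.

(* The descent between a fixed point and the letter [y] depends only on whether
   [y] exceeds its position. *)
Definition exceeds (u : seq int) : bool :=
  if u is y :: u' then Posz (size u').+1 < y else false.

(* A mask records, last position first, which positions carry the letters of the
   derangement; the other ones are fixed points. *)
Fixpoint masks (n : nat) : seq bitseq :=
  if n is m.+1 then map (cons true) (masks m) ++ map (cons false) (masks m)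
  else [:: [::]].

(** [b] describes the later of two adjacent letters, the head of [r] the earlier one. A fixed point
    lies below an adjacent excedance and above an adjacent non-excedance, before and after
    relabelling. *)
Definition shuffle_desc (b : bool) (r : bitseq) (d : seq int) : bool :=
  match b, r with
  | true, true :: _ => head_desc (head 0 d) (behead d)
  | true, false :: _ => ~~ exceeds d
  | false, true :: _ => exceeds d
  | _, _ => false
  end.

(* [rmaj] of the word obtained by inserting fixed points into [d] at the false
   positions of [r], read off from [d] before relabelling its letters. *)
Fixpoint shuffle_maj (r : bitseq) (d : seq int) : nat :=
  if r is b :: r' then
    (shuffle_maj r' (if b then behead d else d) + shuffle_desc b r' d * size r')%N
  else 0%N.

Lemma mem_masks n r : (r \in masks n) = (size r == n).
Proof.
elim: n r => [|n IH] r /=; first by rewrite inE size_eq0.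
rewrite mem_cat; case: r => [|b r] /=.
  by apply/negbTE; rewrite negb_or; apply/andP; split; apply/mapP => -[].
have inj c : injective (cons c : bitseq -> bitseq) by move=> x y [].
have neq c : b != c -> (b :: r \in map (cons c) (masks n)) = false.
  by move=> h; apply/mapP => -[x _ [e _]]; rewrite e eqxx in h.
by case: b neq => neq; rewrite (mem_map (inj _)) IH neq ?orbF ?eqSS.
Qed.

Lemma masks_uniq n : uniq (masks n).
Proof.
have inj c : injective (cons c : bitseq -> bitseq) by move=> x y [].
elim: n => //= n IH; rewrite cat_uniq !(map_inj_uniq (inj _)) IH andbT /=.
by apply/hasPn => _ /mapP[x _ ->]; apply/mapP => -[].
Qed.

Lemma big_masksS (R : nmodType) n (P : pred bitseq) (F : bitseq -> R) :
  \sum_(r <- masks n.+1 | P r) F r =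
  \sum_(r <- masks n | P (true :: r)) F (true :: r) +
  \sum_(r <- masks n | P (false :: r)) F (false :: r).
Proof. by rewrite big_cat !big_map. Qed.

Lemma eq_big_masks (R : nmodType) n (P : pred bitseq) (F G : bitseq -> R) :
  (forall r, size r = n -> P r -> F r = G r) ->
  \sum_(r <- masks n | P r) F r = \sum_(r <- masks n | P r) G r.
Proof.
move=> h; rewrite big_seq_cond [RHS]big_seq_cond; apply: eq_bigr => r.
by rewrite mem_masks => /andP[/eqP /h]; apply.
Qed.

Section ShuffleSums.
Variables (R : comNzRingType) (p : R).

Let Sfix n d := \sum_(r <- masks n | count id r == size d) p ^+ shuffle_maj (false :: r) d.
Let Sder n y d :=
  \sum_(r <- masks n | count id r == size d) p ^+ shuffle_maj (true :: r) (y :: d).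

(** Neither letter is fixed and the positions differ by one, so an excedance lies above an adjacent
    non-excedance. This leaves only the cases in which the recursions of [shuffle_sums] close up. *)
Lemma exceeds_prec x y d : der_word (y :: x :: d) ->
  [/\ exceeds (y :: x :: d) -> ~~ exceeds (x :: d) -> prec y x = false &
      ~~ exceeds (y :: x :: d) -> exceeds (x :: d) -> prec y x].
Proof.
rewrite /= /prec => /andP[h1 /andP[h2 _]].
by case: (ltrP x 0) => hx; case: (ltrP y 0) => hy; split => //; lia.
Qed.

(** The final descent depends on the last two letters, so the sums with a fixed and with a non-fixed
    last letter go through one induction. Removing the last letter leads back to both sums, and each
    combination of [exceeds] and [prec] is one of the two Pascal recursions. *)
Lemma shuffle_sums n :
  (forall d, der_word d -> Sfix n d =
     qbin p n (size d) * p ^+ rmaj d * (if exceeds d then p ^+ size d else 1)) /\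
  (forall y d, der_word (y :: d) -> Sder n y d =
     qbin p n (size d) * p ^+ rmaj (y :: d) *
     (if exceeds (y :: d) then 1 else p ^+ (n - size d))).
Proof.
elim: n => [|n [IHf IHd]]; split.
- move=> [|y d] _; rewrite /Sfix /= big_cons big_nil /=; first by rewrite addr0 !mulr1.
  by rewrite !mul0r.
- move=> y [|x d] _; rewrite /Sder /= big_cons big_nil /=.
    by rewrite muln0 addr0 mulr1; case: ifP; rewrite mulr1.
  by rewrite !mul0r.
- move=> d hd; rewrite /Sfix big_masksS /=.
  rewrite [X in _ + X](_ : _ = Sfix n d); last first.
    apply: eq_big_masks => r hr _ /=; congr (_ ^+ _).
    by case: r {hr} => [|[] r] /=; rewrite ?mul0n ?addn0.
  rewrite IHf //; case: d hd => [|y d] hd.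
    by rewrite big_pred0 // add0r /= qbin0 mulr1.
  rewrite (_ : \sum_(r <- _ | _) _ = p ^+ (exceeds (y :: d) * n.+1) * Sder n y d).
    rewrite IHd // [size (y :: d)]/=.
    have [hs|hs] := leqP (size d) n; last first.
      by rewrite (@qbin_small _ p n) // (@qbin_small _ p n) ?(@qbin_small _ p n.+1) //;
         [ring|lia..].
    have Q1 := qbinS p n (size d); have Q2 := qbinS' p hs.
    have pn : p ^+ n.+1 = p ^+ (n - size d) * p ^+ (size d).+1.
      by rewrite -exprD; congr (_ ^+ _); lia.
    by case: (exceeds _); rewrite ?mul1n ?mul0n ?expr0 ?pn;
      first [rewrite Q1; ring | rewrite Q2; ring].
  rewrite /Sder mulr_sumr; apply: eq_big_masks => r hr _.
  by rewrite -exprD /= hr addnC.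
- move=> y d hd; rewrite /Sder big_masksS /=.
  rewrite [X in _ + X](_ : _ = p ^+ (~~ exceeds (y :: d) * n.+1) * Sfix n d); last first.
    rewrite /Sfix mulr_sumr; apply: eq_big_masks => r hr _.
    by rewrite -exprD /= hr addnC; case: r {hr}.
  have hd' : der_word d by case/andP: hd.
  rewrite IHf //; case: d hd hd' => [|x d] hd hd'.
    rewrite big_pred0 // add0r /= qbin0 !muln0 subn0; case: ifP => _.
      by rewrite mul0n !mulr1.
    by rewrite mul1n !mulr1 mul1r.
  rewrite (_ : \sum_(r <- _ | _) _ = p ^+ (prec y x * n.+1) * Sder n x d); last first.
    rewrite /Sder mulr_sumr; apply: eq_big_masks => r hr _.
    by rewrite -exprD /= hr addnC.
  rewrite IHd //.
  have [hs|hs] := leqP (size d) n; last first.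
    by rewrite !(@qbin_small _ p n) ?(@qbin_small _ p n.+1) //=; [ring|lia..].
  case: (exceeds_prec hd) => h1 h2.
  have Q1 := qbinS p n (size d); have Q2 := qbinS' p hs.
  have pn : p ^+ n.+1 = p ^+ (n - size d) * p ^+ (size d).+1.
    by rewrite -exprD; congr (_ ^+ _); lia.
  rewrite -[_ < y]/(exceeds [:: y, x & d]) [head_desc _ _]/=.
  rewrite [size (x :: d)]/= subSS [in RHS]exprD.
  (* By [exceeds_prec], only six of the eight combinations of the two values of [exceeds] and of
     [prec y x] remain. *)
  have {}h1 : exceeds [:: y, x & d] -> prec y x -> exceeds (x :: d).
    by move=> hy hp; apply/negPn/negP => /(h1 hy); rewrite hp.
  case: (exceeds [:: y, x & d]) h1 h2 => h1 h2.
    case: (prec y x) h1 {h2} => h1; last case: (exceeds (x :: d)) {h1};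
    rewrite ?h1 // ?mul1n ?mul0n ?expr0 ?pn; first [rewrite Q1; ring | rewrite Q2; ring].
  case: (exceeds (x :: d)) h2 => h2; last case: (prec y x) {h2};
    rewrite ?h2 // ?mul1n ?mul0n ?expr0 ?pn; first [rewrite Q1; ring | rewrite Q2; ring].
Qed.

(** In the two sums of [shuffle_sums] the extra power of [p] sits on one or the other term according
    to [exceeds d]. These are the two Pascal recursions, so the total is the same in both cases. *)
Lemma sum_shuffle_maj n d : der_word d ->
  \sum_(r <- masks n | count id r == size d) p ^+ shuffle_maj r d =
  qbin p n (size d) * p ^+ rmaj d.
Proof.
case: n => [|n] hd.
  rewrite /= big_cons big_nil; case: d hd => [|y d] hd //=.
    by rewrite qbin0 addr0 mulr1.
  by rewrite qbin_small // mul0r.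
have [hf hs] := shuffle_sums n.
rewrite big_masksS -/(Sfix n d) hf //.
case: d hd => [|y d] hd; first by rewrite big_pred0 // add0r !qbin0 mulr1.
rewrite -/(Sder n y d) hs // [size (y :: d)]/=.
have [hn|hn] := leqP (size d) n; last first.
  by rewrite !(@qbin_small _ p) ?mul0r ?addr0 //; lia.
have Q1 := qbinS p n (size d); have Q2 := qbinS' p hn.
by case: ifP => _; first [rewrite Q1; ring | rewrite Q2; ring].
Qed.

Lemma sum_shuffle_maj_true n y d : der_word (y :: d) -> ~~ exceeds (y :: d) ->
  \sum_(r <- masks n | count id r == size d) p ^+ shuffle_maj (true :: r) (y :: d) =
  p ^+ (n - size d) * qbin p n (size d) * p ^+ rmaj (y :: d).
Proof.
move=> hd /negbTE he; have [_ /(_ y d hd)] := shuffle_sums n.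
by rewrite he => e; rewrite -[LHS]/(Sder n y d) e; ring.
Qed.

End ShuffleSums.

(** * Signed words *)

(* The position of the [j]-th [true] of [r], counted from the end of [r] and from
   1; beyond [count id r] it is continued so as to stay strictly increasing. *)
Fixpoint true_pos (r : bitseq) (j : nat) : nat :=
  if r is b :: r' then
    if b || (j <= count id r')%N then true_pos r' j else (true_pos r' j).+1
  else j.

(* For every [r] ending the mask, [g] enumerates its [true] positions. *)
Fixpoint compat (g : nat -> nat) (r : bitseq) : Prop :=
  if r is b :: r' then
    compat g r' /\
    (if b then g (count id r').+1 = (size r').+1
     else forall j, g j <> (size r').+1)
  else True.

Definition odd_ext (g : nat -> nat) (x : int) : int :=
  if x < 0 then - Posz (g `|x|%N) else Posz (g `|x|%N).

Fixpoint interleave (r : bitseq) (d : seq int) : seq int :=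
  if r is b :: r' then
    if b then head 0 d :: interleave r' (behead d) else Posz (size r').+1 :: interleave r' d
  else [::].

Fixpoint nonfix (u : seq int) : bitseq :=
  if u is y :: u' then (y != Posz (size u').+1) :: nonfix u' else [::].

Lemma true_pos_gt r i : true_pos r (count id r + i.+1)%N = (size r + i.+1)%N.
Proof.
elim: r i => [|[] r IH] i //=; first by have := IH i.+1; rewrite !addSnnS.
by rewrite addnS ltnNge leq_addr /= -addnS IH addSn.
Qed.

Lemma true_pos_lt r i j : (i < j)%N -> (true_pos r i < true_pos r j)%N.
Proof.
elim: r => //= b r IH h; have := IH h; case: b => //= h'.
by case: (leqP i _) => ?; case: (leqP j _) => ?; lia.
Qed.

Lemma true_pos_le r j : (true_pos r j <= size r)%N = (j <= count id r)%N.
Proof.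
have [h|h] := ltnP (count id r) j.
  have -> : j = (count id r + (j - count id r).-1.+1)%N by lia.
  by rewrite true_pos_gt; lia.
have := true_pos_gt r 0; have : (j < count id r + 1)%N by lia.
by move/(true_pos_lt r); lia.
Qed.

(** [compat] only sees the values of [g] up to [size r]. So [true_pos], whose later values shift as
    the mask grows, stays compatible with the shorter mask. *)
Lemma compat_ext (g g' : nat -> nat) m r : (size r <= m)%N ->
  (forall j, (g j <= m)%N -> g' j = g j) ->
  (forall j, (m < g j)%N -> (m < g' j)%N) ->
  compat g r -> compat g' r.
Proof.
move=> + h1 h2; elim: r => //= b r IH h [/IH{}IH]; split; first by apply: IH; lia.
case: b b0 => //= b0; first by rewrite h1 b0.
by move=> j; have [h3|h3] := leqP (g j) m; [rewrite h1 | have := h2 _ h3; lia].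
Qed.

Lemma compat_true_pos r : compat (true_pos r) r.
Proof.
elim: r => //= -[] r IH /=; first by split=> //; have := true_pos_gt r 0; rewrite !addn1.
split.
  apply: compat_ext (leqnn _) _ _ IH => j; first by rewrite true_pos_le => ->.
  by move=> h; case: ifP => // _; rewrite ltnS ltnW.
by move=> j; case: ifP; rewrite -true_pos_le => h; lia.
Qed.

Lemma size_interleave r d : size (interleave r d) = size r.
Proof. by elim: r d => //= -[] r IH d /=; rewrite IH. Qed.

(** * Relabelling the letters by an increasing map *)

Section Sext.
Variable (g : nat -> nat).
Hypothesis g_lt : forall i j, (i < j)%N -> (g i < g j)%N.

Let g_ltE i j : (g i < g j)%N = (i < j)%N.
Proof.
apply/idP/idP; last exact: g_lt.
by apply: contraTT; rewrite -!leqNgt leq_eqVlt => /orP[/eqP-> //|/g_lt/ltnW].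
Qed.

Lemma odd_ext_lt0 x : (odd_ext g x < 0) = (x < 0).
Proof.
rewrite /odd_ext; case: (ltP x 0) => // h.
by have : (g 0 < g `|x|)%N by [apply: g_lt; lia]; lia.
Qed.

Lemma odd_ext_inj : injective (odd_ext g).
Proof.
have gi i j : g i = g j -> i = j.
  by move=> e; have := g_ltE i j; have := g_ltE j i; rewrite e ltnn; lia.
move=> x y e; have := odd_ext_lt0 x; rewrite e odd_ext_lt0; move: e; rewrite /odd_ext.
case: (ltP x 0) => hx; case: (ltP y 0) => hy // e _.
  by have := gi `|x|%N `|y|%N; lia.
by have := gi `|x|%N `|y|%N; lia.
Qed.

Lemma prec_odd_ext x y : prec (odd_ext g x) (odd_ext g y) = prec x y.
Proof.
rewrite /prec !odd_ext_lt0 /odd_ext; case: (ltP x 0) => hx; case: (ltP y 0) => hy //.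
  by have := g_ltE `|x|%N `|y|%N; lia.
by have := g_ltE `|x|%N `|y|%N; lia.
Qed.

Lemma odd_ext_eq x j : (odd_ext g x == Posz (g j)) = (x == Posz j).
Proof. exact: (inj_eq odd_ext_inj x (Posz j)). Qed.

(** An increasing relabelling keeps the order of two letters of [d]. Next to a fixed point, what
    matters is being an excedance, and this is kept because [g] carries the position of a letter in
    [d] to its position in the word. *)
Lemma rmaj_interleave r d : compat g r -> der_word d -> size d = count id r ->
  rmaj (interleave r (map (odd_ext g) d)) = shuffle_maj r d.
Proof.
elim: r d => //= b r IH d [cr cb] hd.
case: b cb => /= cb hs.
  case: d hd hs => //= y d /andP[hy hd] [hs].
  rewrite IH // size_interleave; congr (_ + _ * _)%N; congr nat_of_bool.
  case: r {IH} cr cb hs => [|[] r] //= [cr cr'] cb hs.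
    by case: d hs {hd hy} => //= x d _; rewrite prec_odd_ext.
  (* The relabelled [y] equals neither the fixed point before it, by [compat], nor its own position,
     by [hy]; so comparing it with either amounts to the same. *)
  have := cr' `|y|%N; have := g_ltE `|y|%N (count id r).+1.
  have := g_ltE (count id r).+1 `|y|%N.
  rewrite cb /prec odd_ext_lt0 /odd_ext /=; case: (ltP y 0) => hy0 /= e1 e2 e3.
    by lia.
  by lia.
rewrite IH // size_interleave; congr (_ + _ * _)%N; congr nat_of_bool.
case: r {IH} cr cb hs => [|[] r] //= [cr cr'] cb hs; last by rewrite /prec /=; lia.
case: d hs hd => //= x d [hs] /andP[hx hd].
have := cb `|x|%N; have := g_ltE `|x|%N (count id r).+1.
have := g_ltE (count id r).+1 `|x|%N.
rewrite cr' /prec odd_ext_lt0 /odd_ext /=; case: (ltP x 0) => hx0 /= e1 e2 e3.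
  by lia.
by lia.
Qed.

(** Letters and positions are relabelled by the same map, so no fixed point is created or destroyed.
    Hence the mask can be read off from the word, which makes the insertion injective. *)
Lemma nonfix_interleave r d : compat g r -> size d = count id r ->
  (nonfix (interleave r (map (odd_ext g) d)) == r) = der_word d.
Proof.
elim: r d => [|b r IH] d /=; first by move=> _ /size0nil ->.
move=> [cr cb]; case: b cb => /= cb.
  case: d => //= y d [hs]; rewrite eqseq_cons IH // size_interleave eqb_id -cb odd_ext_eq hs.
  by [].
by move=> hs; rewrite eqseq_cons IH // size_interleave eqxx.
Qed.

End Sext.

(** * Enumeration of all signed words *)

Fixpoint down (n : nat) : seq nat := if n is m.+1 then n :: down m else [::].

Lemma mem_down n j : (j \in down n) = (0 < j <= n)%N.
Proof. by elim: n => [|n IH] /=; rewrite ?in_nil ?in_cons ?IH; lia. Qed.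

Lemma down_uniq n : uniq (down n).
Proof. by elim: n => //= n ->; rewrite mem_down; lia. Qed.

Lemma size_down n : size (down n) = n.
Proof. by elim: n => //= n ->. Qed.

Fixpoint false_pos (r : bitseq) : seq nat :=
  if r is b :: r' then if b then false_pos r' else (size r').+1 :: false_pos r' else [::].

Lemma perm_interleave r d : size d = count id r ->
  perm_eq (map absz (interleave r d)) (map absz d ++ false_pos r).
Proof.
elim: r d => [|[] r IH] d /=; first by move=> /size0nil ->.
  by case: d => //= y d [hs]; rewrite perm_cons IH.
by move=> hs; rewrite perm_sym perm_catC /= perm_cons perm_catC perm_sym IH.
Qed.

Lemma perm_down_true_pos r :
  perm_eq (down (size r)) (map (true_pos r) (down (count id r)) ++ false_pos r).
Proof.
elim: r => [|[] r IH] //=.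
  by have := true_pos_gt r 0; rewrite !addn1 => ->; rewrite perm_cons.
rewrite perm_sym perm_catC /= perm_cons perm_catC perm_sym.
rewrite (_ : map _ _ = map (true_pos r) (down (count id r))) //.
by apply/eq_in_map => j; rewrite mem_down => /andP[_ ->].
Qed.

Lemma perm_map_lift (S : Type) (T : eqType) (f : S -> T) (s : seq S) (t : seq T) :
  perm_eq t (map f s) -> exists2 Is, perm_eq Is (iota 0 (size s)) &
  forall x0, t = map f (map (nth x0 s) Is).
Proof.
case: s => [|x s'] h; first by exists [::] => // x0; apply/perm_nilP.
move: (x :: s') h => s h; have /(perm_iotaP (f x))[Is h1 e] := h; rewrite size_map in h1.
exists Is => // x0; rewrite e -map_comp; apply/eq_in_map => i hi /=.
have: (i < size s)%N by have := perm_mem h1 i; rewrite hi mem_iota add0n.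
by move=> hi'; rewrite (nth_map x) // (set_nth_default x).
Qed.


Fixpoint signings (P : seq nat) : seq (seq int) :=
  if P is v :: P' then
    map (cons (Posz v)) (signings P') ++ map (cons (- Posz v)) (signings P')
  else [:: [::]].

(** Signs are chosen before the order, so that sums over [swords n] split into sums over the
    permutations of one set of letters, on which [negw] is constant. *)
Definition swords (n : nat) : seq (seq int) :=
  [seq u | E <- signings (down n), u <- permutations E].

Lemma mem_signings P E : (E \in signings P) = (map absz E == P).
Proof.
elim: P E => [|v P IH] [|x E] //=.
  by rewrite mem_cat; apply/negbTE; rewrite negb_or; apply/andP; split; apply/mapP => -[].
have inj c : injective (cons c : seq int -> seq int) by move=> y z [].
have h c : (x :: E \in map (cons c) (signings P)) = (x == c) && (map absz E == P).
  case: eqVneq => [->|hx]; first by rewrite (mem_map (inj c)) IH.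
  by apply/mapP => -[y _ [e _]]; rewrite e eqxx in hx.
by rewrite mem_cat !h eqseq_cons -andb_orl; congr (_ && _); lia.
Qed.

Lemma signings_uniq P : 0%N \notin P -> uniq (signings P).
Proof.
have inj c : injective (cons c : seq int -> seq int) by move=> y z [].
elim: P => //= v P IH; rewrite in_cons negb_or => /andP[hv /IH{}IH].
rewrite cat_uniq !(map_inj_uniq (inj _)) IH andbT /=.
by apply/hasPn => _ /mapP[x _ ->]; apply/mapP => -[y _ []]; lia.
Qed.

Lemma mem_swords n u : (u \in swords n) = perm_eq (map absz u) (down n).
Proof.
apply/allpairsPdep/idP => [[E [w [hE hw ->]]]|h].
  rewrite mem_permutations in hw; rewrite mem_signings in hE.
  by rewrite -(eqP hE) perm_map.
move: h; rewrite perm_sym => /perm_map_lift[Is hI /(_ 0) e].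
exists (map (nth 0 u) Is), u; split => //; first by rewrite mem_signings -e.
rewrite mem_permutations perm_sym; apply/(perm_iotaP 0); by exists Is.
Qed.

Lemma swords_uniq n : uniq (swords n).
Proof.
have n0 : 0%N \notin down n by rewrite mem_down.
apply: allpairs_uniq_dep; first exact: signings_uniq.
  by move=> E _; exact: permutations_uniq.
(* The signing is determined by the word: absolute values are distinct, so [v] and [- v] never both
   occur. *)
have sgnE E u : map absz E = down n -> perm_eq u E ->
    E = [seq (if Posz v \in u then Posz v else - Posz v) | v <- down n].
  move=> hE hu; rewrite -hE -map_comp -[LHS]map_id; apply/eq_in_map => x hx /=.
  rewrite (perm_mem hu); case: (ltP x 0) => hx0; last first.
    by rewrite (_ : Posz `|x|%N = x) ?hx //; lia.
  case: ifP => [h|_]; last by lia.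
  have hU : uniq (map absz E) by rewrite hE down_uniq.
  have ea := nth_index 0 hx; have eb := nth_index 0 h.
  have := @nth_uniq _ 0%N (map absz E) (index x E) (index (Posz `|x|%N) E).
  rewrite size_map !index_mem hx h => /(_ isT isT hU).
  rewrite !(nth_map 0) ?index_mem // ea eb eqxx => /esym/eqP ei.
  by move: eb; rewrite -ei ea; lia.
move=> [E1 u1] [E2 u2] /allpairsPdep[E1' [u1' [h1 h1' [-> ->]]]].
move=> /allpairsPdep[E2' [u2' [h2 h2' [-> ->]]]] /= e.
move: h1' h2'; rewrite !mem_permutations; move: h1 h2; rewrite !mem_signings.
by rewrite e => /eqP h1 /eqP h2 /(sgnE _ _ h1)-> /(sgnE _ _ h2)->.
Qed.

Lemma size_swords n u : u \in swords n -> size u = n.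
Proof. by rewrite mem_swords => /perm_size; rewrite size_map size_down. Qed.

(** * Splitting a signed word into its fixed points and a derangement *)

Lemma interleave_nonfix u : interleave (nonfix u) (mask (nonfix u) u) = u.
Proof.
elim: u => //= y u IH; case: eqVneq => [->|_] /=; rewrite IH //.
by congr (Posz _.+1 :: _); elim: u {IH} => //= x u ->.
Qed.

Lemma size_nonfix u : size (nonfix u) = size u.
Proof. by elim: u => //= y u ->. Qed.

Lemma mask_interleave r d : size d = count id r -> mask r (interleave r d) = d.
Proof.
elim: r d => [|[] r IH] d /=; first by move/size0nil.
  by case: d => //= y d [/IH ->].
exact: IH.
Qed.

Lemma odd_ext_lift g (t : seq nat) (d : seq int) :
  all (fun j => 0 < j)%N t -> map g t = map absz d ->
  exists2 d', map (odd_ext g) d' = d & map absz d' = t.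
Proof.
elim: t d => [|j t IH] [|x d] //=; first by exists [::].
move=> /andP[hj /IH{}IH] [e /IH[d' <- <-]].
exists ((if x < 0 then - Posz j else Posz j) :: d') => /=; congr (_ :: _).
  by rewrite /odd_ext; case: (ltP x 0) => hx; case: ltP; rewrite ?abszN ?absz_nat ?e; lia.
by case: ifP; rewrite ?abszN.
Qed.

Definition insert_fix (r : bitseq) (d : seq int) : seq int := interleave r (map (odd_ext (true_pos r)) d).

(** [nonfix] recovers the mask; then [mask] and the injectivity of [odd_ext] recover the
    derangement. Conversely, the fixed points of a word use up the false positions as values, so the
    absolute values of the other letters fill the true positions and can be pulled back along
    [true_pos]. *)
Lemma perm_swords_insert_fix n :
  perm_eq (swords n)
    [seq insert_fix r d | r <- masks n, d <- [seq d <- swords (count id r) | der_word d]].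
Proof.
apply: uniq_perm; first exact: swords_uniq.
  apply: allpairs_uniq_dep; first exact: masks_uniq.
    by move=> r _; apply: filter_uniq; exact: swords_uniq.
  move=> [r1 d1] [r2 d2] /allpairsPdep[r1' [d1' [_ h1 [-> ->]]]].
  move=> /allpairsPdep[r2' [d2' [_ h2 [-> ->]]]] /= e.
  move: h1 h2; rewrite !mem_filter => /andP[h1 /size_swords s1] /andP[h2 /size_swords s2].
  have er : r1' = r2'.
    have := nonfix_interleave (@true_pos_lt r1') (compat_true_pos r1') s1.
    have := nonfix_interleave (@true_pos_lt r2') (compat_true_pos r2') s2.
    by rewrite h1 h2 -/(insert_fix r2' d2') -e => /eqP<- /eqP.
  move: e s1 s2 {h1 h2}; rewrite -{}er => e s1 s2; congr (existT _ _ _).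
  move: e => /(congr1 (mask r1')); rewrite !mask_interleave ?size_map //.
  by move/(inj_map (odd_ext_inj (@true_pos_lt r1'))).
move=> u; apply/idP/allpairsPdep => [hu|[r [d [hr hd ->]]]]; last first.
  move: hd; rewrite mem_filter mem_swords => /andP[_ hd].
  have sd : size d = count id r by move/perm_size: hd; rewrite size_map size_down.
  move: hr; rewrite mem_masks => /eqP <-; rewrite mem_swords /insert_fix.
  have hm : size (map (odd_ext (true_pos r)) d) = count id r by rewrite size_map.
  rewrite (permPl (perm_interleave hm)) perm_sym (permPl (perm_down_true_pos r)) perm_cat2r.
  rewrite -map_comp (_ : map (absz \o _) d = map (true_pos r) (map absz d)).
    by rewrite perm_sym perm_map.
  by rewrite -map_comp; apply/eq_map => x /=; rewrite /odd_ext; case: ifP; rewrite ?abszN.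
have su := size_swords hu; move: hu; rewrite mem_swords => hu.
set r := nonfix u; set d := mask r u.
have sr : size r = n by rewrite size_nonfix.
have sd : size d = count id r by rewrite size_mask ?size_nonfix.
have eu : interleave r d = u := interleave_nonfix u.
move: hu; rewrite -eu (permPl (perm_interleave sd)) -sr perm_sym.
rewrite (permPl (perm_down_true_pos r)) perm_cat2r perm_sym.
move=> /perm_map_lift[Is hI /(_ 0%N)].
set t := map _ Is => et.
have ht : perm_eq t (down (count id r)).
  by apply/(perm_iotaP 0%N); exists Is.
have [] := @odd_ext_lift (true_pos r) t d _ (esym et).
  by apply/allP => j; rewrite (perm_mem ht) mem_down => /andP[].
move=> d' ed ed'; exists r, d'; split; first by rewrite mem_masks sr.
  rewrite mem_filter mem_swords ed' ht andbT.
  have sd' : size d' = count id r by rewrite -sd -ed size_map.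
  by rewrite -(nonfix_interleave (@true_pos_lt r) (compat_true_pos r) sd') ed eu eqxx.
by rewrite /insert_fix ed.
Qed.

(** * Sums over all signed words *)

Lemma precxx x : prec x x = false.
Proof. by rewrite /prec; case: (ltP x 0); rewrite ltxx. Qed.

Lemma prec_trans y x z : prec x y -> prec y z -> prec x z.
Proof.
by rewrite /prec; case: (ltP x 0); case: (ltP y 0); case: (ltP z 0) => //; lia.
Qed.

Lemma prec_total x y : x != y -> ~~ prec x y -> prec y x.
Proof.
by rewrite /prec; case: (ltP x 0); case: (ltP y 0) => //; lia.
Qed.

(** Ranks are counted from the top: the largest letter has rank 0. *)
Definition rank (s : seq int) (c : int) : nat := count (prec c) s.

Lemma rank_lt s c c' : c' \in s -> prec c c' -> (rank s c' < rank s c)%N.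
Proof.
move=> hc' h; rewrite /rank.
have : (count (predU (prec c') (pred1 c')) s <= count (prec c) s)%N.
  apply: sub_count => v /orP[/(prec_trans h)//|/eqP-> //].
have := count_predUI (prec c') (pred1 c') s.
rewrite (@eq_count _ (predI _ _) pred0) ?count_pred0; last first.
  by move=> v /=; case: eqVneq => [->|]; rewrite ?precxx ?andbF.
have : (0 < count_mem c' s)%N by rewrite -has_count has_pred1.
rewrite addn0 => h0 -> ; apply: leq_trans.
by rewrite -addn1 leq_add2l.
Qed.

Lemma rank_lt_size s c : c \in s -> (rank s c < size s)%N.
Proof.
move=> hc; rewrite /rank -(count_predC (prec c) s) -[X in (X < _)%N]addn0 ltn_add2l.
by rewrite -has_count; apply/hasP; exists c; rewrite //= precxx.
Qed.

Lemma perm_ranks s : uniq s -> perm_eq (map (rank s) s) (iota 0 (size s)).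
Proof.
move=> hs; have hu : uniq (map (rank s) s).
  rewrite map_inj_in_uniq // => x y hx hy e; apply/eqP/negPn/negP => hn.
  have [h|/negbTE h] := boolP (prec x y).
    by have := rank_lt hy h; rewrite e ltnn.
  by have := rank_lt hx (prec_total hn (negbT h)); rewrite e ltnn.
have sub : {subset map (rank s) s <= iota 0 (size s)}.
  by move=> _ /mapP[x hx ->]; rewrite mem_iota add0n rank_lt_size.
have [|_ h] := uniq_min_size hu sub; first by rewrite size_iota size_map.
by apply: uniq_perm => //; exact: iota_uniq.
Qed.

Lemma prec_rank s c c' : c \notin s -> c' \in s -> prec c c' = (rank s c' < rank s c)%N.
Proof.
move=> hc hc'; apply/idP/idP; first exact: rank_lt.
apply: contraTT => h; rewrite -leqNgt; apply: sub_count => v.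
by apply: prec_trans; apply: prec_total h; apply: contraNneq hc => ->.
Qed.

Lemma big_permutations (R : nmodType) (s : seq int) (F : seq int -> R) P :
  uniq s -> (0 < size s)%N ->
  \sum_(u <- permutations s | P u) F u =
  \sum_(x <- s) \sum_(u <- permutations (rem x s) | P (x :: u)) F (x :: u).
Proof.
move=> hs h0; rewrite (perm_big _ (permutationsE h0)) undup_id //= big_mkcond.
rewrite big_allpairs_dep; apply: eq_bigr => x _; by rewrite -big_mkcond.
Qed.

Section MajSums.
Variables (R : comNzRingType) (p : R).

Lemma sum_rank s (F : nat -> R) : uniq s ->
  \sum_(x <- s) F (rank s x) = \sum_(0 <= j < size s) F j.
Proof.
move=> hs; rewrite -(big_map (rank s) xpredT F) (perm_big _ (perm_ranks hs)).
by rewrite /index_iota subn0.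
Qed.

Lemma sum_nat_qint n : \sum_(0 <= j < n) p ^+ j = qint n p.
Proof. exact: big_mkord. Qed.

(** The exponents [0, ..., a - 1] are moved to [n, ..., n + a - 1], which leaves the consecutive
    exponents [a, ..., n + a - 1]. *)
Lemma sum_shifted_pow n a : (a <= n)%N ->
  \sum_(0 <= j < n) p ^+ ((j < a) * n + j) = p ^+ a * qint n p.
Proof.
move=> han; rewrite (big_cat_nat (leq0n a) han) /=.
rewrite (eq_big_nat _ _ (F2 := fun j => p ^+ n * p ^+ j)); last first.
  by move=> j hj; rewrite (_ : (j < a)%N) ?mul1n ?exprD //; lia.
rewrite -mulr_sumr sum_nat_qint.
rewrite [X in _ + X](_ : _ = \sum_(0 <= j < n - a) p ^+ a * p ^+ j); last first.
  rewrite -{1}[a]add0n big_addn; apply: eq_big_nat => j hj.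
  by rewrite (_ : (j + a < a)%N = false) ?mul0n ?add0n ?exprD 1?mulrC //; lia.
rewrite -mulr_sumr sum_nat_qint -[in RHS](subnK han) qintD.
by rewrite mulrDr mulrA -exprD subnKC // addrC.
Qed.

Lemma rank_rem s x : rank (rem x s) x = rank s x.
Proof.
have [hx|hx] := boolP (x \in s); last by rewrite rem_id.
by rewrite /rank (seq.permP (perm_to_rem hx)) /= precxx.
Qed.

(** A refinement of MacMahon's theorem by the last letter [c]. If [x] stands before [c], there is a
    descent at position [size s] exactly when [x] has smaller rank than [c], so induction leads to
    [sum_shifted_pow]. *)
Lemma sum_permutations_rmaj_cons s c : uniq s -> c \notin s ->
  \sum_(u <- permutations s) p ^+ rmaj (c :: u) = p ^+ rank s c * qfact p (size s).
Proof.
move: {2}(size s) (erefl (size s)) => n.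
elim: n s c => [|n IH] s c hn hs hc.
  move/size0nil: hn => ->.
  have -> : permutations [::] = [:: [::] : seq int] by [].
  by rewrite big_seq1 /= qfact0 mulr1.
have h0 : (0 < size s)%N by rewrite hn.
rewrite big_permutations // hn qfactS mulrCA -sum_shifted_pow -hn ?count_size //.
rewrite -(sum_rank (fun j => p ^+ ((j < rank s c) * size s + j))) // mulr_sumr.
rewrite big_seq_cond [RHS]big_seq_cond; apply: eq_bigr => x /andP[hx _].
have hr : size (rem x s) = n by rewrite size_rem ?hn.
rewrite -(prec_rank hc hx) exprD mulrCA -rank_rem.
have := IH (rem x s) x hr (rem_uniq x hs); rewrite hr mulrC => <- //; last first.
  by rewrite mem_rem_uniq // inE eqxx.
rewrite mulr_sumr big_seq_cond [RHS]big_seq_cond; apply: eq_bigr => u.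
rewrite mem_permutations => /andP[/perm_size hu _].
by rewrite -exprD /= hu hr hn addnC.
Qed.

Lemma sum_permutations_rmaj s : uniq s ->
  \sum_(u <- permutations s) p ^+ rmaj u = qfact p (size s).
Proof.
case: (posnP (size s)) => [/size0nil -> _|h0 hs].
  have -> : permutations [::] = [:: [::] : seq int] by [].
  by rewrite big_seq1 /= qfact0.
rewrite big_permutations //; case e : (size s) h0 => [|n] // _.
rewrite qfactS -sum_nat_qint -e -(sum_rank (fun j => p ^+ j)) // mulr_sumr.
rewrite big_seq_cond [RHS]big_seq_cond; apply: eq_bigr => x /andP[hx _].
have hr : size (rem x s) = n by rewrite size_rem ?e.
rewrite sum_permutations_rmaj_cons ?hr ?rem_uniq ?rank_rem 1?mulrC //.
by rewrite mem_rem_uniq // inE eqxx.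
Qed.

Variable t : R.

Lemma sum_signings_negw P : 0%N \notin P ->
  \sum_(E <- signings P) t ^+ negw E = (1 + t) ^+ size P.
Proof.
elim: P => [|v P IH]; first by rewrite big_seq1.
rewrite in_cons negb_or => /andP[hv /IH{}IH] /=.
rewrite big_cat !big_map /= exprS mulrDl mul1r -IH mulr_sumr; congr (_ + _).
apply: eq_bigr => E _; rewrite -exprS; congr (_ ^+ _).
by rewrite /negw /= (_ : (- Posz v < 0)) //; lia.
Qed.

Lemma signings_props P E : uniq P -> E \in signings P ->
  uniq E /\ size E = size P.
Proof.
rewrite mem_signings => hu /eqP h; split; last by rewrite -h size_map.
by apply: (@map_uniq _ _ absz); rewrite h.
Qed.

Lemma sum_swords_rmaj n :
  \sum_(u <- swords n) t ^+ negw u * p ^+ rmaj u = (1 + t) ^+ n * qfact p n.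
Proof.
rewrite big_allpairs_dep -[in RHS](size_down n) -sum_signings_negw; last by rewrite mem_down.
rewrite mulr_suml big_seq_cond [RHS]big_seq_cond; apply: eq_bigr => E /andP[hE _].
have [hu hs] := signings_props (down_uniq n) hE.
rewrite -hs -sum_permutations_rmaj // mulr_sumr.
rewrite big_seq_cond [RHS]big_seq_cond; apply: eq_bigr => u.
by rewrite mem_permutations => /andP[/seq.permP hp _]; rewrite /negw hp.
Qed.

(** By [sum_permutations_rmaj_cons], [p ^ rank E c] is, up to a common factor, the weight of the
    permutations of [E] with last letter [c]. *)
Definition posrank (E : seq int) : R := \sum_(c <- E | 0 <= c) p ^+ rank E c.

(** [m.+1] is the largest letter: it has rank 0 and raises all other ranks by one. *)
Lemma posrank_pos m E : map absz E = down m ->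
  posrank (Posz m.+1 :: E) = 1 + p * posrank E.
Proof.
move=> hE; have hlt x : x \in E -> (`|x| <= m)%N.
  by move=> hx; have := map_f absz hx; rewrite hE mem_down => /andP[].
rewrite /posrank big_cons /= /rank /= precxx add0n.
have -> : count (prec m.+1) E = 0%N.
  rewrite (@eq_in_count _ _ pred0) ?count_pred0 // => x /hlt.
  by rewrite /prec /=; case: (ltP x 0) => //; lia.
congr (_ + _); rewrite mulr_sumr big_seq_cond [RHS]big_seq_cond.
apply: eq_bigr => c /andP[/hlt hc h0].
by rewrite -exprS; congr (_ ^+ _); rewrite /prec ltNge h0 /= (_ : c < m.+1) //; lia.
Qed.

(** Negative letters lie below all positive ones and do not affect their ranks. *)
Lemma posrank_neg m E : (0 < m)%N -> posrank (- Posz m :: E) = posrank E.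
Proof.
move=> m0; rewrite /posrank big_cons ifF; last by lia.
apply: eq_bigr => c h0; rewrite /rank /= {1}/prec.
by rewrite ltNge h0 /= (_ : - Posz m < 0) //; lia.
Qed.

Definition signed_posrank n : R := \sum_(E <- signings (down n)) t ^+ negw E * posrank E.

Lemma signed_posrank0 : signed_posrank 0 = 0.
Proof. by rewrite /signed_posrank big_seq1 /posrank big_nil mulr0. Qed.

Lemma signed_posrankS n :
  signed_posrank n.+1 = (p + t) * signed_posrank n + (1 + t) ^+ n.
Proof.
rewrite /signed_posrank [signings _]/= big_cat !big_map.
rewrite -[X in _ = _ + _ ^+ X](size_down n) -sum_signings_negw ?mem_down //.
rewrite mulr_sumr -[RHS]big_split -[LHS]big_split /= big_seq_cond [RHS]big_seq_cond.
apply: eq_bigr => E /andP[]; rewrite mem_signings => /eqP hE _.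
rewrite posrank_neg // posrank_pos //= add0n exprS; ring.
Qed.

(** If [n.+1] is positive, excluding it as last letter drops the summand 1 of [posrank_pos] and
    leaves the factor [p]. If it is negative, it gives a factor [t] and changes no rank of a
    positive letter. *)
Lemma sum_swords_last_pos n :
  \sum_(u <- swords n.+1 | (0 <= head 0 u) && (head 0 u != Posz n.+1))
     t ^+ negw u * p ^+ rmaj u =
  (p + t) * signed_posrank n * qfact p n.
Proof.
rewrite big_mkcond big_allpairs_dep.
rewrite (eq_big_seq (fun E => qfact p n * (t ^+ negw E *
   \sum_(c <- E | (0 <= c) && (c != Posz n.+1)) p ^+ rank E c))); last first.
  move=> E hE; have [hu hs] := signings_props (down_uniq n.+1) hE.
  rewrite size_down in hs.
  rewrite big_permutations ?hs // [X in _ = _ * (_ * X)]big_mkcond mulrA mulr_sumr.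
  rewrite big_seq_cond [RHS]big_seq_cond; apply: eq_bigr => c /andP[hc _] /=.
  case: ifP => _; last by rewrite big1 ?mulr0.
  have hr : size (rem c E) = n by rewrite size_rem ?hs.
  rewrite -rank_rem -mulrA mulrCA [qfact p n * _]mulrC -hr.
  rewrite -sum_permutations_rmaj_cons ?rem_uniq ?mem_rem_uniq ?inE ?eqxx // mulr_sumr.
  rewrite big_seq_cond [RHS]big_seq_cond; apply: eq_bigr => u.
  rewrite mem_permutations => /andP[hp _]; congr (t ^+ _ * _).
  rewrite /negw (seq.permP (perm_to_rem hc)) /=; congr (_ + _)%N; exact/seq.permP.
rewrite -mulr_sumr mulrC; congr (_ * _).
rewrite [signings _]/= big_cat !big_map /signed_posrank mulr_sumr -[LHS]big_split /=.
rewrite big_seq_cond [RHS]big_seq_cond.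
apply: eq_bigr => E /andP[]; rewrite mem_signings => /eqP hE _.
have hlt x : x \in E -> (`|x| <= n)%N.
  by move=> hx; have := map_f absz hx; rewrite hE mem_down => /andP[].
rewrite !big_cons eqxx /=.
have e F : \sum_(c <- E | (0 <= c) && (c != Posz n.+1)) F c =
    \sum_(c <- E | 0 <= c) F c :> R.
  rewrite big_seq_cond [RHS]big_seq_cond; apply: eq_bigl => c.
  by case: (boolP (c \in E)) => //= /hlt; lia.
have -> : \sum_(c <- E | (0 <= c) && (c != Posz n.+1)) p ^+ rank (Posz n.+1 :: E) c =
    p * posrank E.
  have := posrank_pos hE; rewrite /posrank big_cons /= e /rank /= precxx add0n.
  have -> : count (prec n.+1) E = 0%N.
    rewrite (@eq_in_count _ _ pred0) ?count_pred0 // => x /hlt.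
    by rewrite /prec /=; case: (ltP x 0) => //; lia.
  by move/addrI.
rewrite e; have := @posrank_neg n.+1 E isT; rewrite /posrank big_cons /= => ->.
by rewrite /= add0n exprS; ring.
Qed.

End MajSums.

(** Here [p + t] is [q (1 + q)], so the recursion [signed_posrankS] becomes that of [qint]. The
    factor [1 + q] on the left avoids a division. *)
Lemma signed_posrank_sq (R : comNzRingType) (q : R) n :
  (1 + q) * signed_posrank (q ^+ 2) q n = (1 + q) ^+ n * qint n q.
Proof.
elim: n => [|n IH].
  by rewrite signed_posrank0 qint0 !mulr0.
rewrite signed_posrankS mulrDr mulrCA IH qintSl [_ ^+ n.+1]exprS expr2; ring.
Qed.

(** * Sums over derangements *)

Lemma negw_insert_fix r d : size d = count id r -> negw (insert_fix r d) = negw d.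
Proof.
rewrite /insert_fix /negw => hs.
have -> : count (fun x : int => x < 0) d =
          count (fun x : int => x < 0) (map (odd_ext (true_pos r)) d).
  by rewrite count_map; apply: eq_count => x; rewrite /= odd_ext_lt0 //; exact: true_pos_lt.
move: hs; rewrite -(size_map (odd_ext (true_pos r)) d).
move: (map (odd_ext (true_pos r)) d) => e.
elim: r e => [|[] r IH] e /=; first by move/size0nil->.
  by case: e => //= x e [/IH ->].
by move/IH->.
Qed.

Lemma rmaj_insert_fix r d : der_word d -> size d = count id r ->
  rmaj (insert_fix r d) = shuffle_maj r d.
Proof. exact: (rmaj_interleave (@true_pos_lt r) (compat_true_pos r)). Qed.

Lemma exchange_masks (R : nmodType) n (F : nat -> bitseq -> R) :
  \sum_(r <- masks n) F (count id r) r =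
  \sum_(k < n.+1) \sum_(r <- masks n | count id r == k) F k r.
Proof.
rewrite (exchange_big_dep xpredT) //=; apply: eq_big_masks => r hr _.
have hk : (count id r < n.+1)%N by rewrite ltnS -hr count_size.
rewrite (big_pred1 (Ordinal hk)) //.
Qed.

Section Decomposition.
Variables (R : comNzRingType) (p t : R).

Definition der_sum k : R := \sum_(u <- swords k | der_word u) t ^+ negw u * p ^+ rmaj u.

Definition der_last_pos_sum k : R :=
  \sum_(u <- swords k | der_word u && (0 <= head 0 u)) t ^+ negw u * p ^+ rmaj u.

Lemma sum_swords_der n :
  (1 + t) ^+ n * qfact p n = \sum_(k < n.+1) qbin p n k * der_sum k.
Proof.
rewrite -sum_swords_rmaj (perm_big _ (perm_swords_insert_fix n)) /= big_allpairs_dep.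
pose F k r := \sum_(d <- [seq d <- swords k | der_word d]) t ^+ negw d * p ^+ shuffle_maj r d.
rewrite (eq_bigr (fun r => F (count id r) r)).
  rewrite exchange_masks; apply: eq_bigr => k _; rewrite exchange_big /= big_filter.
  rewrite /der_sum mulr_sumr big_seq_cond [RHS]big_seq_cond.
  apply: eq_bigr => d /andP[/size_swords hs hd].
  by rewrite -mulr_sumr -{1}hs sum_shuffle_maj // hs mulrCA.
move=> r _; apply: eq_big_seq => d; rewrite mem_filter => /andP[hd /size_swords hs].
by rewrite negw_insert_fix ?rmaj_insert_fix.
Qed.

Lemma head_swords n y d : y :: d \in swords n -> (0 < `|y| <= n)%N.
Proof.
rewrite mem_swords => /perm_mem/(_ `|y|%N); rewrite in_cons eqxx mem_down.
by move=> <-.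
Qed.

Lemma sum_swords_der_last_pos n :
  (p + t) * signed_posrank p t n * qfact p n =
  \sum_(k < n.+1) p ^+ (n - k) * qbin p n k * der_last_pos_sum k.+1.
Proof.
rewrite -sum_swords_last_pos big_mkcond (perm_big _ (perm_swords_insert_fix n.+1)).
(* A mask with a fixed point in last position gives the last letter [n.+1], which is excluded. *)
rewrite big_allpairs_dep big_masksS addrC [X in X + _]big1_seq ?add0r; last first.
  move=> r /andP[_]; rewrite mem_masks => /eqP hr; rewrite big1 // => d _.
  by rewrite ifF // /insert_fix /= hr eqxx.
pose F k r := \sum_(d <- swords k.+1 | der_word d && (0 <= head 0 d))
  t ^+ negw d * p ^+ shuffle_maj (true :: r) d.
rewrite (eq_big_seq (fun r => F (count id r) r)).
  rewrite exchange_masks; apply: eq_bigr => k _; rewrite exchange_big.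
  rewrite /der_last_pos_sum mulr_sumr big_seq_cond [RHS]big_seq_cond.
  apply: eq_bigr => -[|y d] /andP[hs /andP[hd _]]; first by have := size_swords hs.
  have hy := head_swords hs; have [hk] := size_swords hs.
  (* The last letter of a word of length [k.+1] is at most [k.+1], so it is not an excedance. *)
  rewrite -mulr_sumr -hk sum_shuffle_maj_true //; last by move: hy => /=; lia.
  by rewrite mulrCA.
move=> r; rewrite mem_masks => /eqP hr; rewrite big_filter /F.
rewrite [RHS]big_mkcondr big_seq_cond [RHS]big_seq_cond.
apply: eq_bigr => -[|y d] /andP[hs hd]; first by have := size_swords hs.
have hy := head_swords hs; have sd := size_swords hs.
rewrite negw_insert_fix // rmaj_insert_fix //.
have pl := @true_pos_lt (true :: r); have := @odd_ext_lt0 _ pl y.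
have := @odd_ext_eq _ pl y (count id r).+1.
have := true_pos_gt r 0; rewrite !addn1 => /= -> e1 e2.
rewrite -hr e1 !leNgt e2; case/andP: hd => hd _.
by case: sd hd => ->; case: eqVneq => //; rewrite andbT.
Qed.

End Decomposition.

(** * Signed permutations as words *)

Lemma majp_rev u : majp (rev u) = rmaj u.
Proof.
elim: u => [|y [|x u] IH]; [by rewrite /majp big_ord0 | by rewrite /majp big_ord0 |].
rewrite -[rmaj (y :: _)]/(rmaj (x :: u) + prec y x * (size u).+1)%N -IH /majp !size_rev.
rewrite big_mkcond [in RHS]big_mkcond /= big_ord_recr /=; congr (_ + _)%N.
  apply: eq_bigr => i _; rewrite rev_cons !nth_rcons size_rev /=.
  by rewrite ltnS ltn_ord (ltn_trans (ltn_ord i)) // ltnS.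
rewrite !rev_cons !nth_rcons !size_rcons !size_rev ltnn eqxx ltnS leqnn ltnn eqxx.
by case: (prec y x); rewrite ?mul1n ?mul0n.
Qed.

Lemma der_word_rev u :
  reflect (forall i, (i < size u)%N -> nth 0 (rev u) i != Posz i.+1) (der_word u).
Proof.
elim: u => [|y u IH] /=; first by constructor.
apply: (iffP andP) => [[hy /IH h] i|h]; rewrite ?rev_cons.
  rewrite nth_rcons size_rev ltnS leq_eqVlt => /orP[/eqP->|hi]; first by rewrite ltnn eqxx.
  by rewrite hi h.
split; first by have := h _ (leqnn _); rewrite rev_cons nth_rcons size_rev ltnn eqxx.
apply/IH => i hi; have := h i (ltnW hi).
by rewrite rev_cons nth_rcons size_rev hi.
Qed.

Lemma negw_rev u : negw (rev u) = negw u.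
Proof. by rewrite /negw count_rev. Qed.

Lemma size_sp_word n (sg : signed_perm n) : size (sp_word sg) = n.
Proof. by rewrite size_map size_enum_ord. Qed.

Lemma nth_sp_word n (sg : signed_perm n) (i : 'I_n) :
  nth 0 (sp_word sg) i = if sg.2 i then - Posz (sg.1 i).+1 else Posz (sg.1 i).+1.
Proof. by rewrite (nth_map i) ?nth_ord_enum // size_enum_ord. Qed.

Lemma sp_word_inj n : injective (@sp_word n).
Proof.
move=> [p1 s1] [p2 s2] e.
have h (i : 'I_n) : p1 i = p2 i /\ s1 i = s2 i.
  have := congr1 (fun w => nth 0 w i) e; rewrite !nth_sp_word /=.
  by case: (s1 i); case: (s2 i) => h; (split; [apply/val_inj => /=; lia | done || lia]).
by congr (_, _); [apply/permP | apply/ffunP] => i; have [] := h i.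
Qed.

Lemma sp_word_surj n w : perm_eq (map absz w) (down n) -> exists sg : signed_perm n, sp_word sg = w.
Proof.
move=> hw; have sw : size w = n by move/perm_size: hw; rewrite size_map size_down.
have hr (i : 'I_n) : (0 < `|nth 0%R w i|%N <= n)%N.
  rewrite -mem_down -(perm_mem hw); apply: map_f; apply: mem_nth.
  by rewrite sw.
have lt (i : 'I_n) : (`|nth 0%R w i|%N.-1 < n)%N by have := hr i; lia.
have inj : injective (fun i => Ordinal (lt i)).
  move=> i j /(congr1 val) /= e; apply/ord_inj/eqP.
  have hu : uniq (map absz w) by rewrite (perm_uniq hw) down_uniq.
  rewrite -(nth_uniq 0%N _ _ hu) ?size_map ?sw //.
  rewrite !(nth_map 0) ?sw ?ltn_ord //; apply/eqP.
  by case/andP: (hr i) => /prednK <- _; case/andP: (hr j) => /prednK <- _; rewrite e.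
exists (perm inj, [ffun i : 'I_n => nth 0 w i < 0]).
apply: (@eq_from_nth _ 0); rewrite size_sp_word ?sw // => i hi.
rewrite (nth_sp_word _ (Ordinal hi)) /= permE ffunE /=.
case/andP: (hr (Ordinal hi)) => /= /prednK -> _.
by case: (ltP (nth 0 w i) 0) => h; [rewrite ltz0_abs ?opprK | rewrite gez0_abs].
Qed.

Lemma perm_swords_sp_word n :
  perm_eq (swords n) [seq rev (sp_word sg) | sg : signed_perm n].
Proof.
apply: uniq_perm; first exact: swords_uniq.
  by rewrite map_inj_uniq ?enum_uniq // => s1 s2 /(can_inj revK)/sp_word_inj.
move=> u; rewrite mem_swords; apply/idP/mapP => [hu|[sg _ ->]].
  have [|sg e] := @sp_word_surj n (rev u); first by rewrite map_rev perm_rev.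
  by exists sg; rewrite ?mem_enum // e revK.
rewrite map_rev perm_rev -map_comp; apply: uniq_perm; last 1 first.
- move=> j; rewrite mem_down; apply/mapP/idP => [[i _ ->] /=|hj].
    by have := ltn_ord (sg.1 i); case: (sg.2 i) => /=; lia.
  have hj' : (j.-1 < n)%N by lia.
  exists ((sg.1)^-1%g (Ordinal hj')); first by rewrite mem_enum.
  by rewrite /= permKV /=; case: (sg.2 _); lia.
- rewrite map_inj_uniq ?enum_uniq // => i j /= e; apply: (@perm_inj _ sg.1).
  by apply/val_inj => /=; move: e; case: (sg.2 i); case: (sg.2 j); lia.
exact: down_uniq.
Qed.

Definition abs_head (u : seq int) : seq int :=
  if u is y :: u' then Posz `|y|%N :: u' else [::].

Definition flip_head (u : seq int) : seq int :=
  if u is y :: u' then - y :: u' else [::].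

Lemma sum_DD_swords (R : comNzRingType) (q : R) n :
  \sum_(sg : signed_perm n.+1 | inDD sg) q ^+ Dmaj sg =
  \sum_(u <- swords n.+1 | ~~ odd (negw u) && der_word u)
     q ^+ (2 * rmaj (abs_head u) + negw (abs_head u)).
Proof.
rewrite (perm_big _ (perm_swords_sp_word n.+1)) big_map /= big_enum_cond /=.
apply: eq_big => sg; rewrite /inDD /inD.
  rewrite negw_rev; congr (_ && _); apply/forallP/der_word_rev => h i.
    by rewrite revK size_rev size_sp_word => hi; exact: (h (Ordinal hi)).
  by have := h i; rewrite revK size_rev size_sp_word; apply.
move=> _; rewrite /Dmaj /fmaj; case/lastP e : (sp_word sg) => [|w y].
  by have := size_sp_word sg; rewrite e.
have hw : size w = n by have := size_sp_word sg; rewrite e size_rcons => -[].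
have -> : take n.+1.-1 (rcons w y) = w by rewrite -cats1; exact: take_size_cat.
rewrite last_rcons rev_rcons /= -{1 2}[w]revK -rev_cons majp_rev negw_rev.
by [].
Qed.

(** * The sum over type D derangements *)

Lemma flip_headK : involutive flip_head.
Proof. by case=> //= y u; rewrite opprK. Qed.

Lemma mem_flip_head n u : (flip_head u \in swords n) = (u \in swords n).
Proof. by rewrite !mem_swords; case: u => //= y u; rewrite abszN. Qed.

Lemma perm_flip_head n : perm_eq (swords n) (map flip_head (swords n)).
Proof.
apply: uniq_perm; rewrite ?(map_inj_uniq (inv_inj flip_headK)) ?swords_uniq // => u.
by rewrite -[u in RHS]flip_headK (mem_map (inv_inj flip_headK)) mem_flip_head.
Qed.

(** Letters are nonzero, so each pair of words differing in the sign of the last letter contains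
    exactly one with positive last letter. *)
Lemma sum_swords_flip (R : nmodType) n (H : seq int -> R) :
  \sum_(u <- swords n.+1) H u =
  \sum_(u <- swords n.+1 | 0 <= head 0 u) (H u + H (flip_head u)).
Proof.
rewrite (bigID (fun u => 0 <= head 0 u)) /= big_split; congr (_ + _).
rewrite (perm_big _ (perm_flip_head n.+1)) big_map.
rewrite big_seq_cond [RHS]big_seq_cond; apply: eq_bigl => -[|y u] /=.
  by case: (boolP (_ \in _)) => // /size_swords.
by case: (boolP (_ \in _)) => //= /head_swords; lia.
Qed.

Lemma perm_last_max n :
  perm_eq [seq u <- swords n.+1 | head 0 u == Posz n.+1] (map (cons (Posz n.+1)) (swords n)).
Proof.
have inj : injective (cons (Posz n.+1)) by move=> x y [].
apply: uniq_perm; rewrite ?(map_inj_uniq inj) ?filter_uniq ?swords_uniq // => u.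
rewrite mem_filter; case: u => [|y u] /=.
  by apply/esym/negbTE/mapP => -[].
case: eqVneq => [->|hy] /=; first by rewrite (mem_map inj) !mem_swords /= perm_cons.
by apply/esym/negbTE/mapP => -[x _ [e _]]; rewrite e eqxx in hy.
Qed.

Lemma rmaj_cons_max n u : u \in swords n -> rmaj (Posz n.+1 :: u) = rmaj u.
Proof.
case: u => [|x u] //= /head_swords hx.
rewrite /prec /=; case: (ltP x 0) => h; first by rewrite addn0.
by rewrite (_ : (Posz n.+1 < x) = false) ?addn0 //; lia.
Qed.

(** A word and its flip have the same weight, and exactly one of them has an even number of negative
    letters. If the last letter is not [n.+1] up to sign, they are derangements together and one of
    them counts. Otherwise only the flip, ending in [- n.+1], can be a derangement, and it counts
    when the unflipped word has odd [negw]. *)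
Lemma sum_DD_split (R : comNzRingType) (q : R) n :
  \sum_(sg : signed_perm n.+1 | inDD sg) q ^+ Dmaj sg =
  der_last_pos_sum (q ^+ 2) q n.+1 +
  \sum_(u <- swords n | der_word u && odd (negw u)) q ^+ negw u * (q ^+ 2) ^+ rmaj u.
Proof.
rewrite sum_DD_swords big_mkcond sum_swords_flip.
pose W u := q ^+ negw u * (q ^+ 2) ^+ rmaj u.
(* Words on [n] letters are extended by [n.+1], which is largest in the order and so adds no descent
   at the end. *)
have -> : \sum_(u <- swords n | der_word u && odd (negw u)) W u =
    \sum_(u <- swords n.+1 | (0 <= head 0 u))
      (if (head 0 u == Posz n.+1) && (der_word (behead u) && odd (negw u)) then W u else 0).
  apply/esym; rewrite big_mkcond /=.
  transitivity (\sum_(u <- [seq u <- swords n.+1 | head 0 u == Posz n.+1])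
     (if der_word (behead u) && odd (negw u) then W u else 0)).
    rewrite big_filter [RHS]big_mkcond; apply: eq_bigr => u _.
    by case: eqVneq => [->|_] //=; rewrite if_same.
  rewrite (perm_big _ (perm_last_max n)) big_map [RHS]big_mkcond.
  apply: eq_big_seq => u hu; rewrite /W rmaj_cons_max //=.
rewrite /der_last_pos_sum big_mkcondl -big_split /=.
rewrite big_seq_cond [RHS]big_seq_cond; apply: eq_bigr => -[|y u] /andP[hu h0].
  by have := size_swords hu.
have hy := head_swords hu; have [su] := size_swords hu.
rewrite /= abszN in h0 *; rewrite gez0_abs //.
have -> : (y < 0) = false by lia.
have -> : (- y < 0) = true by lia.
have -> : (- y != Posz (size u).+1) by lia.
rewrite su; have eW : q ^+ (2 * (rmaj u + head_desc y u * size u) + (false + negw u)) = W (y :: u).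
  by rewrite /W exprD exprM mulrC /= (_ : (y < 0) = false) //; lia.
rewrite -su eW /W /= (_ : (y < 0) = false); last by lia.
case: eqVneq => _; case: (der_word u); case: (odd (negw u)) => /=; rewrite ?addr0 ?add0r //.
Qed.

Lemma sum_odd_negw (R : numFieldType) (q : R) n :
  \sum_(u <- swords n | der_word u && odd (negw u)) q ^+ negw u * (q ^+ 2) ^+ rmaj u =
  2^-1 * (der_sum (q ^+ 2) q n - der_sum (q ^+ 2) (- q) n).
Proof.
rewrite /der_sum -sumrB mulr_sumr big_mkcondr; apply: eq_bigr => u _.
rewrite -mulrBl exprNn -signr_odd; case: (odd _) => /=.
  by rewrite expr1; field.
by rewrite expr0 mul1r subrr mul0r mulr0.
Qed.

Lemma der_sumE (R : comNzRingType) (p t : R) n :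
  der_sum p t n = \sum_(k < n.+1)
    (-1) ^+ k * p ^+ 'C(k, 2) * qbin p n k * ((1 + t) ^+ (n - k) * qfact p (n - k)).
Proof.
rewrite (@qbin_inversion _ p 1 (fun m => (1 + t) ^+ m * qfact p m) (der_sum p t)) => [|m].
  by apply: eq_bigr => k _; rewrite expr1n mulr1.
by rewrite sum_swords_der; apply: eq_bigr => k _; rewrite expr1n mul1r.
Qed.

(** The factor [p ^ (n - k)] of [sum_swords_der_last_pos] calls for inversion with [a := p], whence
    the extra [p ^ k]. *)
Lemma der_last_pos_sumE (R : comNzRingType) (p t : R) n :
  der_last_pos_sum p t n.+1 = \sum_(k < n.+1)
    (-1) ^+ k * p ^+ k * p ^+ 'C(k, 2) * qbin p n k *
    ((p + t) * signed_posrank p t (n - k) * qfact p (n - k)).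
Proof.
rewrite (@qbin_inversion _ p p
  (fun m => (p + t) * signed_posrank p t m * qfact p m)
  (fun m => der_last_pos_sum p t m.+1)) // => m.
by rewrite sum_swords_der_last_pos.
Qed.

Lemma qint_double (R : comNzRingType) (q : R) n :
  qint (2 * n) q = (1 + q) * qint n (q ^+ 2).
Proof.
elim: n => [|n IH]; first by rewrite !qint0 mulr0.
by rewrite mulnS add2n !qintSl IH; ring.
Qed.

Lemma prod_qint_double (R : comNzRingType) (q : R) n :
  \prod_(1 <= j < n.+1) qint (2 * j) q = (1 + q) ^+ n * qfact (q ^+ 2) n.
Proof.
elim: n => [|n IH]; first by rewrite big_nil qfact0 mulr1.
by rewrite big_nat_recr //= IH qint_double qfactS [_ ^+ n.+1]exprS; ring.
Qed.

Unset Implicit Arguments.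

Theorem theorem4p4 (R : numFieldType) (n : nat) (q : R)
  (hn : (2 <= n)%N)
  (hq : 1 + q != 0)
  (hden : \prod_(1 <= j < n.-1) qint (2 * j) q != 0) :
  \sum_(sg : signed_perm n | inDD sg) q ^+ Dmaj sg =
  (\prod_(1 <= j < n) qint (2 * j) q) *
  \sum_(k < n.-1)
     ((-1) ^+ k * q ^+ (2 * 'C(k, 2)) / (\prod_(1 <= j < k.+1) qint (2 * j) q) *
      (q ^+ (2 * k + 1) * qint (n - 1 - k) q
       + 2^-1 * (1 - ((1 - q) / (1 + q)) ^+ (n - k - 1)))).
Proof.
case: n hn hden => [//|[//|m]] _ /= hden.
rewrite sum_DD_split sum_odd_negw der_last_pos_sumE !der_sumE -sumrB mulr_sumr.
(* Both parts of the term [k = m.+1] vanish: [signed_posrank] is 0 at 0, and the powers of [1 + q]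
   and [1 - q] are both 1. So the sum ends at [n - 2]. *)
rewrite -big_split big_ord_recr /= subnn signed_posrank0 !expr0.
rewrite !mulr0 mul0r mulr0 add0r subrr mulr0 addr0 mulr_sumr.
apply: eq_bigr => -[k hk] _ /=.
rewrite !prod_qint_double.
set G := fun j => (1 + q) ^+ j * qfact (q ^+ 2) j.
(* [G k] divides the product in [hden], since [k <= m]. *)
have Gk : G k != 0.
  move: hden; rewrite (@big_cat_nat _ _ _ k.+1) //= prod_qint_double.
  by rewrite mulf_eq0 negb_or => /andP[].
have eG : G m.+1 / G k = qbin (q ^+ 2) m.+1 k * G (m.+1 - k)%N.
  apply: (mulIf Gk); rewrite divfK //.
  have fE := @qbin_fact _ (q ^+ 2) m.+1 k (ltnW hk).
  have pE : (1 + q) ^+ m.+1 = (1 + q) ^+ (m.+1 - k) * (1 + q) ^+ k.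
    by rewrite -exprD subnK // ltnW.
  by rewrite /G pE -fE; move: (qfact _ _) (qfact _ _) (qbin _ _ _) => a b c; ring.
rewrite -/(G m.+1) -/(G k).
have -> : (m.+2 - 1 - k = m.+1 - k)%N by lia.
have -> : (m.+2 - k - 1 = m.+1 - k)%N by lia.
set j := (m.+1 - k)%N in eG *.
have S2 : (q ^+ 2 + q) * signed_posrank (q ^+ 2) q j = q * ((1 + q) ^+ j * qint j q).
  by rewrite -signed_posrank_sq; ring.
(* By [hq], the power of [1 - q] coming from [t = - q] is the fraction of the statement times the
   power of [1 + q] coming from [t = q]. *)
have r1 : ((1 - q) / (1 + q)) ^+ j * (1 + q) ^+ j = (1 - q) ^+ j.
  by rewrite -exprMn divfK.
have -> : G m.+1 * ((-1) ^+ k * q ^+ (2 * 'C(k, 2)) / G k *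
   (q ^+ (2 * k + 1) * qint j q + 2^-1 * (1 - ((1 - q) / (1 + q)) ^+ j))) =
   (G m.+1 / G k) * ((-1) ^+ k * q ^+ (2 * 'C(k, 2)) *
   (q ^+ (2 * k + 1) * qint j q + 2^-1 * (1 - ((1 - q) / (1 + q)) ^+ j))) by ring.
rewrite eG /G S2 -r1 -!exprM exprD expr1.
move: (qfact _ _) (qbin _ _ _) (qint _ _) (((1 - q) / (1 + q)) ^+ j) ((1 + q) ^+ j).
move: (q ^+ (2 * 'C(k, 2))) (q ^+ (2 * k)) ((-1) ^+ k) => *.
ring.
Qed.
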